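(* Let $d\ge1$, $\rho>0$, and let $K$ be a finite simplicial complex with $K$ combinatorially equivalent to $\check{C}(V,\rho)$ for some finite vertex set $V\subset\mathbb{R}^d$ (i.e. $K$ has a $d$-dimensional Čech representation with parameter $\rho$). Let $\eta$ be a stationary Poisson point process on $\mathbb{R}^d$ with intensity $t>0$. Then almost surely the infinite Čech complex $\check{C}(\eta,\rho)$ contains infinitely many isolated simplicial complexes $K_n$, $n\in\mathbb{N}$, each combinatorially equivalent to $K$.
   Context: For a locally finite set $X\subset\mathbb{R}^d$, the Čech complex $\check{C}(X,\rho)$ is the abstract simplicial complex on vertex set $X$ whose simplices are the finite subsets $\{x_0,\dots,x_k\}\subset X$ for which there exists $y\in\mathbb{R}^d$ with $\|x_i-y\|_2\le\rho/2$ for all $i$. A stationary Poisson point process $\eta$ on $\mathbb{R}^d$ with intensity $t$ is a Poisson point process with intensity measure $t\Lambda_d$ ($\Lambda_d$ = Lebesgue measure); $\check{C}(\eta,\rho)$ is the Čech complex of its random support $\{x:\eta(\{x\})>0\}$. Two simplicial complexes are combinatorially equivalent if there is a bijection of vertex sets mapping faces exactly onto faces. An isolated subcomplex is an induced subcomplex on a vertex set $W$ such that no edge of the ambient complex joins a vertex of $W$ to a vertex outside $W$. *)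

(* Defs.v *)
From HB Require Import structures.
From mathcomp Require Import all_boot all_order all_algebra finmap.
From mathcomp Require Import all_classical all_reals all_analysis.
From mathcomp Require Import measurable_realfun.
Set Implicit Arguments.
Unset Strict Implicit.
Unset Printing Implicit Defensive.
Import Order.TTheory GRing.Theory Num.Theory.
Import numFieldNormedType.Exports.
Local Open Scope classical_set_scope.
Local Open Scope ring_scope.

(** [n.-tuple T] carries the product sigma-algebra, which for
    [T := measurableTypeR R] is the Borel sigma-algebra of R^n. *)
Notation euclidean R n := (n.-tuple (measurableTypeR R)).

Section lebesgue_euclidean.
Context {R : realType}.
Local Open Scope ereal_scope.

Definition consT n (p : measurableTypeR R * euclidean R n) :
  euclidean R n.+1 := [the n.+1.-tuple _ of p.1 :: p.2].

Lemma measurable_consT n : measurable_fun setT (@consT n).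
Proof. exact: measurable_cons. Qed.

Section step.
Context n (mu : {sigma_finite_measure set (euclidean R n) -> \bar R}).

(** The product of the Lebesgue measure on R with [mu], carried over to
    R^(n+1) by the identification R * R^n = R^(n+1). *)
Definition lebesgue_cons : set (euclidean R n.+1) -> \bar R :=
  pushforward (@lebesgue_measure R \x mu) (@consT n).

Let measurable_consT_preimage A : measurable A -> measurable (@consT n @^-1` A).
Proof. by rewrite -[X in _ -> measurable X]setTI; exact: measurable_consT. Qed.

Let lebesgue_cons0 : lebesgue_cons set0 = 0.
Proof. by rewrite /lebesgue_cons /pushforward preimage_set0 measure0. Qed.

Let lebesgue_cons_ge0 A : 0 <= lebesgue_cons A.
Proof. by apply: integral_ge0 => x _ /=. Qed.

Let lebesgue_cons_sigma_additive : semi_sigma_additive lebesgue_cons.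
Proof.
move=> F mF tF mUF; rewrite /lebesgue_cons /pushforward preimage_bigcup.
apply: measure_semi_sigma_additive.
- by move=> k; exact: measurable_consT_preimage.
- apply/trivIsetP => i j _ _ ij; rewrite -preimage_setI.
  by move/trivIsetP : tF => /(_ _ _ _ _ ij) ->//; rewrite preimage_set0.
- by rewrite -preimage_bigcup; exact: measurable_consT_preimage.
Qed.

HB.instance Definition _ := isMeasure.Build _ _ _ lebesgue_cons
  lebesgue_cons0 lebesgue_cons_ge0 lebesgue_cons_sigma_additive.

Let lebesgue_cons_sigma_finite : sigma_finite setT lebesgue_cons.
Proof.
have /sigma_finiteP[F [TF ndF Foo]] := sigma_finiteT (@lebesgue_measure R).
have /sigma_finiteP[G [TG ndG Goo]] := sigma_finiteT mu.
pose unconsT (t : euclidean R n.+1) : measurableTypeR R * euclidean R n :=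
  (thead t, [tuple of behead t]).
have consTK : cancel (@consT n) unconsT.
  by case=> x t; congr pair; apply: val_inj.
have munconsT : measurable_fun setT unconsT.
  by apply: measurable_fun_pair; [exact: measurable_tnth|exact: measurable_behead].
exists (fun k => unconsT @^-1` (F k `*` G k)).
  rewrite -preimage_bigcup (_ : \bigcup_k _ = setT) ?preimage_setT//.
  apply/seteqP; split=> // -[x t] _.
  have [k _ Fkx] : (\bigcup_k F k) x by rewrite -TF.
  have [l _ Glt] : (\bigcup_k G k) t by rewrite -TG.
  exists (maxn k l) => //; split => /=.
  - by move: x Fkx; exact/subsetPset/ndF/leq_maxl.
  - by move: t Glt; exact/subsetPset/ndG/leq_maxr.
move=> k; have [mF Fk] := Foo k; have [mG Gk] := Goo k; split.
  by rewrite -[X in measurable X]setTI; apply: munconsT => //; exact: measurableX.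
rewrite /lebesgue_cons /pushforward.
rewrite (_ : _ @^-1` _ = F k `*` G k); last first.
  by apply/seteqP; split => p; rewrite /preimage /mkset consTK.
by rewrite product_measure1E// lte_mul_pinfty// ge0_fin_numE.
Qed.

HB.instance Definition _ := @Measure_isSigmaFinite.Build _ _ _ lebesgue_cons
  lebesgue_cons_sigma_finite.

End step.

Fixpoint lebesgue_measure_euclidean (n : nat) :
    {sigma_finite_measure set (euclidean R n) -> \bar R} :=
  match n with
  | 0 => \d_[tuple]
  | n'.+1 => lebesgue_cons (lebesgue_measure_euclidean n')
  end.

Lemma lebesgue_measure_euclidean_box n (A : 'I_n -> set (measurableTypeR R)) :
  (forall i, measurable (A i)) ->
  lebesgue_measure_euclidean n [set x | forall i, A i (tnth x i)] =
  \prod_(i < n) lebesgue_measure (A i).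
Proof.
elim: n A => [|n IHn] A mA.
  rewrite big_ord0 /= diracE mem_set//= => -[].
  by [].
have mB (k : nat) (B : 'I_k -> set (measurableTypeR R)) :
    (forall i, measurable (B i)) ->
    measurable [set x : euclidean R k | forall i, B i (tnth x i)].
  move=> mB; rewrite [X in measurable X](_ : _ =
      \bigcap_(i in [set: 'I_k]) ((fun x : euclidean R k => tnth x i) @^-1` B i)).
    apply: fin_bigcap_measurable => [|i _]; first exact: finite_finset.
    by rewrite -[X in measurable X]setTI; exact: measurable_tnth.
  by apply/seteqP; split=> [x Bx i _|x Bx i]; [exact: Bx|exact: (Bx i I)].
have mA' j : measurable (A (lift ord0 j)) by exact: mA.
rewrite big_ord_recl -(IHn _ mA').
have mBA := mB _ _ mA'.
rewrite -product_measure1E//=.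
rewrite /lebesgue_cons /pushforward; congr product_measure1.
apply/seteqP; split=> [[x t]/= Axt|[x t]/= [Ax At] i].
- split=> [|i]; first exact: (Axt ord0).
  by have := Axt (lift ord0 i); rewrite tnthS.
- by case: (unliftP ord0 i) => [j ->|-> //]; rewrite tnthS.
Qed.

End lebesgue_euclidean.
Arguments lebesgue_measure_euclidean : clear implicits.

(** Abstract simplicial complexes. Faces are nonempty, and the vertex set is the
    set of points whose singleton is a face. *)
Record simplicial_complex (T : choiceType) := SimplicialComplex {
  faces : set {fset T};
  faces_neq0 : forall s, faces s -> s != fset0;
  faces_sub : forall s u : {fset T},
    faces s -> (u `<=` s)%fset -> u != fset0 -> faces u }.

Definition vertices (T : choiceType) (K : simplicial_complex T) : set T :=
  [set x | faces K [fset x]%fset].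

Definition combinatorially_equivalent (T U : choiceType)
    (K : simplicial_complex T) (L : simplicial_complex U) :=
  exists2 f : T -> U, set_bij (vertices K) (vertices L) f &
    forall s : {fset T}, [set` s] `<=` vertices K ->
      faces K s <-> faces L (f @` s)%fset.

Section induced.
Context (T : choiceType) (K : simplicial_complex T) (W : set T).

Definition induced_faces : set {fset T} := [set s | faces K s /\ [set` s] `<=` W].

Lemma induced_faces_neq0 s : induced_faces s -> s != fset0.
Proof. by case=> /faces_neq0. Qed.

Lemma induced_faces_sub (s u : {fset T}) :
  induced_faces s -> (u `<=` s)%fset -> u != fset0 -> induced_faces u.
Proof.
move=> [Ks sW] us u0; split; first exact: faces_sub us u0.
by move=> x /= /(fsubsetP us)/sW.
Qed.

Definition induced_subcomplex :=
  SimplicialComplex induced_faces_neq0 induced_faces_sub.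

End induced.

Definition isolated_subcomplex (T : choiceType) (K L : simplicial_complex T) :=
  exists W : set T, [/\ W `<=` vertices K, L = induced_subcomplex K W &
    forall x y, W x -> ~ W y -> ~ faces K [fset x; y]%fset].

Section cech.
Context {R : realType} {d : nat}.

Definition euclidean_dist (x y : euclidean R d) : R :=
  Num.sqrt (\sum_(i < d) ((tnth x i : R) - (tnth y i : R)) ^+ 2).

Context (X : set (euclidean R d)) (rho : R).

Definition cech_faces : set {fset euclidean R d} :=
  [set s | [/\ s != fset0, [set` s] `<=` X &
    exists y, forall x, x \in s -> euclidean_dist x y <= rho / 2]].

Lemma cech_faces_neq0 s : cech_faces s -> s != fset0.
Proof. by case. Qed.

Lemma cech_faces_sub (s u : {fset euclidean R d}) :
  cech_faces s -> (u `<=` s)%fset -> u != fset0 -> cech_faces u.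
Proof.
move=> [s0 sX [y sy]] us u0; split => //.
- by move=> x /= /(fsubsetP us)/sX.
- by exists y => x /(fsubsetP us)/sy.
Qed.

Definition cech := SimplicialComplex cech_faces_neq0 cech_faces_sub.

Lemma vertices_cech : 0 <= rho -> vertices cech = X.
Proof.
move=> rho0; apply/seteqP; split=> [x [_ + _]|x Xx].
  by apply => /=; rewrite inE.
split; first by apply/fset0Pn; exists x; rewrite inE.
- by move=> y /=; rewrite inE => /eqP ->.
- exists x => y; rewrite inE => /eqP ->.
  rewrite /euclidean_dist big1 ?sqrtr0 ?divr_ge0// => i _.
  by rewrite subrr expr0n.
Qed.

End cech.

Section poisson_process.
Context d (Omega : measurableType d) (R : realType) (P : probability Omega R).
Local Open Scope ereal_scope.

(** Poisson variables with parameter in [0, +oo]; as usual, a Poisson variable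
    with parameter +oo is almost surely infinite. The [nat] argument of
    [poisson_prob] is ignored by the library definition. *)
Definition poisson_variable (N : Omega -> \bar R) (m : \bar R) : Prop :=
  match m with
  | r%:E => forall k : nat,
      P [set w | N w = k%:R%:E] = poisson_prob r 0 [set k]
  | +oo => P [set w | N w = +oo] = 1
  | -oo => False
  end.

(** Taking some of the [A i] to be [setT] gives the product rule for
    subfamilies. *)
Definition mutually_independent n (N : 'I_n -> Omega -> \bar R) : Prop :=
  forall A : 'I_n -> set (\bar R), (forall i, measurable (A i)) ->
    P (\bigcap_i (N i @^-1` A i)) = \prod_(i < n) P (N i @^-1` A i).

Context d' (S : measurableType d') (eta : Omega -> {measure set S -> \bar R}).

(** Local finiteness is not part of the definition: for a Poisson process with
    locally finite intensity measure it holds almost surely. *)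
Definition point_process : Prop :=
  (forall w B, measurable B ->
     eta w B = +oo \/ exists k : nat, eta w B = k%:R%:E) /\
  (forall B, measurable B -> measurable_fun setT (fun w => eta w B)).

Definition poisson_process (mu : set S -> \bar R) : Prop :=
  [/\ point_process,
      forall B, measurable B -> poisson_variable (fun w => eta w B) (mu B) &
      forall n (B : 'I_n -> set S), (forall i, measurable (B i)) ->
        trivIset setT B -> mutually_independent (fun i w => eta w (B i))].

End poisson_process.

Definition stationary_poisson_process (R : realType) (d : nat)
    (disp : measure_display) (Omega : measurableType disp)
    (P : probability Omega R)
    (eta : Omega -> {measure set (euclidean R d) -> \bar R}) (t : R) : Prop :=
  poisson_process P eta (fun B => t%:E * lebesgue_measure_euclidean R d B)%E.

Definition support_of (R : realType) (d : nat)
    (mu : {measure set (euclidean R d) -> \bar R}) : set (euclidean R d) :=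
  [set x | (0 < mu [set x])%E].

(* Main.v *)
(** Shrinking a representation of [K] slightly makes it robust: every
    configuration [x] with [x i] in a small cube around [q i] has the same Čech
    complex. Place disjoint translates of a large cube containing all the small
    cubes with margin [rho]. With a probability bounded below, each small cube
    of a given translate contains exactly one point of the process and the rest
    of the large cube none, and then the points in the large cube span an
    isolated copy of [K]. These events are independent, so almost surely
    infinitely many of them occur. *)
Require Import Defs.
From HB Require Import structures.
From mathcomp Require Import all_boot all_order all_algebra finmap.
From mathcomp Require Import all_classical all_reals all_analysis.
From mathcomp Require Import measurable_realfun ring lra.
Set Implicit Arguments.
Unset Strict Implicit.
Unset Printing Implicit Defensive.
Import Order.TTheory GRing.Theory Num.Theory.
Import numFieldNormedType.Exports.
Local Open Scope classical_set_scope.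
Local Open Scope ring_scope.

(** * Configurations whose enclosable subsets survive small perturbations *)

Lemma finite_uniform_pos (R : realType) (I : finType) (P : I -> R -> Prop) :
  (forall i, exists2 e, 0 < e & P i e) ->
  (forall i a b, 0 < a -> a <= b -> P i b -> P i a) ->
  exists2 e, 0 < e & forall i, P i e.
Proof.
move=> Pex Pmono.
have /choice[e eP] : forall i, exists x, 0 < x /\ P i x.
  by move=> i; have [x x0 Px] := Pex i; exists x.
have m0 : 0 < \big[Num.min/1]_i e i.
  elim/big_ind: _ => [//|x y x0 y0|i _]; last by case: (eP i).
  by rewrite lt_min x0.
exists (\big[Num.min/1]_i e i) => // i.
by apply: (Pmono _ _ (e i)) => //; [exact: bigmin_le|case: (eP i)].
Qed.

Section sqdist.
Context {R : realType} {d : nat}.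
Implicit Types x y z : euclidean R d.

(** Squares keep the later estimates polynomial, free of roots. *)
Definition sqdist x y : R :=
  \sum_(j < d) ((tnth x j : R) - (tnth y j : R)) ^+ 2.

Lemma euclidean_dist_le x y (r : R) : 0 <= r ->
  (euclidean_dist x y <= r) = (sqdist x y <= r ^+ 2).
Proof.
move=> r0; rewrite -[in LHS](ger0_norm r0) -sqrtr_sqr.
by rewrite ler_sqrt// sqr_ge0.
Qed.

Lemma sqr_coord_le x y j :
  ((tnth x j : R) - (tnth y j : R)) ^+ 2 <= sqdist x y.
Proof.
rewrite /sqdist (bigD1 j)//= lerDl.
by apply: sumr_ge0 => k _; exact: sqr_ge0.
Qed.

End sqdist.

(** The Čech face condition on index sets instead of point sets, so that two configurations over the
    same [I] can be compared directly. *)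
Definition enclosable (R : realType) (d : nat) (I : finType)
    (p : I -> euclidean R d) (s : {set I}) (r : R) :=
  exists y, forall i, i \in s -> euclidean_dist (p i) y <= r.

Section row_vectors.
Context {R : realType} {d : nat}.

(** Row vectors carry the topology used for compactness, tuples the sigma-algebra. *)
Definition tuple_of_row (u : 'rV[R]_d) : euclidean R d :=
  [tuple (u ord0 j : measurableTypeR R) | j < d].

Lemma sqdist_continuous (x : euclidean R d) :
  continuous (fun u : 'rV[R]_d => sqdist x (tuple_of_row u)).
Proof.
apply: continuous_big => [|j _ u].
  exact: add_continuous.
rewrite /=; under eq_fun do rewrite tnth_mktuple.
apply: (@continuous_comp _ _ _ (fun v : 'rV[R]_d => (tnth x j : R) - v ord0 j)
  (fun z : R => z ^+ 2)); last exact: exprn_continuous.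
by apply: (@continuousB _ _ _ (fun=> _) (fun v : 'rV[R]_d => v ord0 j));
  [exact: cst_continuous|exact: coord_continuous].
Qed.

Lemma tuple_of_rowK (y : euclidean R d) :
  tuple_of_row (\row_j (tnth y j : R)) = y.
Proof. by apply: eq_from_tnth => j; rewrite tnth_mktuple mxE. Qed.

End row_vectors.

(* The total excess over the closed ball condition attains its minimum on a
   compact box; were its infimum zero, a minimizer would be a common center. *)
Lemma enclosable_gap (R : realType) (d : nat) (I : finType)
    (p : I -> euclidean R d) (s : {set I}) (r : R) :
  0 <= r -> ~ enclosable p s r ->
  exists2 e, 0 < e & forall y, exists2 i, i \in s & r ^+ 2 + e < sqdist (p i) y.
Proof.
move=> r0 ns.
have [s0|[i0 i0s]] := set_0Vmem s.
  by case: ns; exists (tuple_of_row 0) => i; rewrite s0 inE.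
have s0 : (0 < #|s|)%N by apply/card_gt0P; exists i0.
pose F (u : 'rV[R]_d) :=
  \sum_(i in s) Num.max 0 (sqdist (p i) (tuple_of_row u) - r ^+ 2).
have F0 u : 0 <= F u by apply: sumr_ge0 => i _; rewrite le_max lexx.
have cF : continuous F.
  apply: continuous_big => [|i _ u]; first exact: add_continuous.
  apply: (@continuous_max _ _ (fun=> 0)
    (fun v => sqdist (p i) (tuple_of_row v) - r ^+ 2));
    first exact: cst_continuous.
  by apply: (@continuousB _ _ _ (fun v => sqdist (p i) (tuple_of_row v))
    (fun=> _)); [apply: sqdist_continuous|exact: cst_continuous].
(* If [a ^+ 2 <= r ^+ 2 + 1] then [a <= a ^+ 2 + 1 <= b], so the box of half-width [b] contains
   every [y] with [sqdist (p i0) y <= r ^+ 2 + 1]. *)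
pose b := r ^+ 2 + 2.
pose A := [set u : 'rV[R]_d | forall j,
  `[(tnth (p i0) j : R) - b, (tnth (p i0) j : R) + b]%classic (u ord0 j)].
have cA : compact A.
  by apply: (@rV_compact R d (fun j => `[(tnth (p i0) j : R) - b,
    (tnth (p i0) j : R) + b]%classic)) => j; exact: segment_compact.
have A0 : A !=set0.
  exists (\row_j (tnth (p i0) j : R)) => j; rewrite mxE /= in_itv /= /b.
  by have := sqr_ge0 r; lra.
have [c _ Fc] := EVT_min_rV A0 cA (continuous_subspaceT cF).
have Fc0 : 0 < F c.
  rewrite lt_neqAle F0 andbT; apply/eqP => /esym Fc0; apply: ns.
  exists (tuple_of_row c) => i si; rewrite euclidean_dist_le//.
  have : sqdist (p i) (tuple_of_row c) - r ^+ 2 <=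
      Num.max 0 (sqdist (p i) (tuple_of_row c) - r ^+ 2).
    by rewrite le_max lexx orbT.
  rewrite (psumr_eq0P _ Fc0)// ?subr_le0// => k _.
  by rewrite le_max lexx.
(* The bound 1 keeps a violating center inside the box; the factor 2 makes its total excess at most
   [F c / 2], strictly below the minimum. *)
exists (Num.min 1 (F c / (2 * #|s|%:R))).
  by rewrite lt_min ltr01/= divr_gt0// mulr_gt0// ltr0n.
set e := Num.min _ _ => y.
apply: contrapT => noi.
have {noi} yle i : i \in s -> sqdist (p i) y <= r ^+ 2 + e.
  by move=> si; rewrite leNgt; apply/negP => h; apply: noi; exists i.
have e1 : e <= 1 by rewrite ge_min lexx.
have e2 : e <= F c / (2 * #|s|%:R) by rewrite ge_min lexx orbT.
have e0 : 0 <= e by rewrite le_min ler01/= divr_ge0// mulr_ge0.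
have Ay : A (\row_j (tnth y j : R)).
  move=> j; rewrite mxE /= in_itv /= -ler_distl distrC.
  have := le_trans (sqr_coord_le (p i0) y j) (yle _ i0s).
  rewrite -real_normK ?num_real// /b.
  move: `|_| (normr_ge0 ((tnth (p i0) j : R) - tnth y j)) => a a0.
  by have := sqr_ge0 r; nra.
have := Fc _ (mem_set Ay); rewrite leNgt => /negP; apply.
apply: (@le_lt_trans _ _ (\sum_(i in s) e)).
  apply: ler_sum => i si; rewrite ge_max e0/= tuple_of_rowK.
  by rewrite lerBlDl yle.
rewrite sumr_const -mulr_natr.
apply: (@le_lt_trans _ _ (F c / 2)); last by lra.
rewrite -ler_pdivlMr ?ltr0n//; apply: (le_trans e2).
by rewrite invfM mulrA.
Qed.

(** The two sides differ by [c * (1 - c) * (u - w) ^+ 2]. *)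
Lemma sqr_convex_comb (R : realDomainType) (c u w : R) : 0 <= c <= 1 ->
  (c * u + (1 - c) * w) ^+ 2 <= c * u ^+ 2 + (1 - c) * w ^+ 2.
Proof.
move=> /andP[c0 c1]; have : 0 <= c * (1 - c) * (u - w) ^+ 2.
  by rewrite mulr_ge0 ?sqr_ge0// mulr_ge0 ?subr_ge0.
by nra.
Qed.

(** Convexity of the squared norm, applied to difference vectors; the three pairs may thus live at
    different scales. *)
Lemma sqdist_convex (R : realType) (d : nat) (c : R)
    (x y u v a b : euclidean R d) : 0 <= c <= 1 ->
  (forall j, (tnth x j : R) - tnth y j =
    c * ((tnth u j : R) - tnth v j) + (1 - c) * ((tnth a j : R) - tnth b j)) ->
  sqdist x y <= c * sqdist u v + (1 - c) * sqdist a b.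
Proof.
move=> c01 xy; rewrite /sqdist !mulr_sumr -big_split/=.
by apply: ler_sum => j _; rewrite xy sqr_convex_comb.
Qed.

Definition scale_point (R : realType) (d : nat) (c : R) (x : euclidean R d) :
  euclidean R d := [tuple (c * tnth x j : measurableTypeR R) | j < d].

Lemma tnth_scale_point (R : realType) (d : nat) (c : R) (x : euclidean R d) j :
  tnth (scale_point c x) j = c * tnth x j :> R.
Proof. by rewrite tnth_mktuple. Qed.

Lemma sqdist_scale (R : realType) (d : nat) (c : R) (x y : euclidean R d) :
  sqdist (scale_point c x) (scale_point c y) = c ^+ 2 * sqdist x y.
Proof.
rewrite /sqdist mulr_sumr; apply: eq_bigr => j _.
by rewrite !tnth_scale_point -mulrBr exprMn.
Qed.

Lemma sqdist_sup_le (R : realType) (d : nat) (x y : euclidean R d) (e : R) :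
  (forall j, `|(tnth x j : R) - tnth y j| <= e) -> sqdist x y <= d%:R * e ^+ 2.
Proof.
move=> xye; rewrite /sqdist.
apply: (@le_trans _ _ (\sum_(j < d) e ^+ 2)).
  apply: ler_sum => j _; rewrite -[leLHS]real_normK ?num_real//.
  by rewrite lerXn2r// ?nnegrE// (le_trans _ (xye j)).
by rewrite big_const_ord iter_addr_0 mulr_natl.
Qed.

(* Shrinking a configuration makes each of its common balls strictly smaller
   than needed, while the finitely many non-faces have a gap, so that both
   survive a small perturbation. *)
Lemma robust_configuration (R : realType) (d : nat) (I : finType)
    (p : I -> euclidean R d) (r : R) : injective p -> 0 < r ->
  exists q : I -> euclidean R d, exists2 e : R, 0 < e &
    (forall i k, i != k ->
      exists j, 2 * e < `|(tnth (q i) j : R) - tnth (q k) j|)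
    /\ forall x : I -> euclidean R d,
      (forall i j, `|(tnth (x i) j : R) - tnth (q i) j| <= e) ->
      forall s, enclosable p s r <-> enclosable x s r.
Proof.
move=> pI r0; have r2 : 0 < r ^+ 2 by rewrite exprn_gt0.
have [g g0 gP] : exists2 g : R, 0 < g & forall ik : I * I, ik.1 != ik.2 ->
    exists j, g < `|(tnth (p ik.1) j : R) - tnth (p ik.2) j|.
  apply: (@finite_uniform_pos R _ (fun ik g => ik.1 != ik.2 ->
    exists j, g < `|(tnth (p ik.1) j : R) - tnth (p ik.2) j|)).
    move=> [i k]/=; have [->|ik] := eqVneq i k; first by exists 1.
    have [j pj] : exists j, (tnth (p i) j : R) != tnth (p k) j.
      apply: contrapT => noj; move/eqP: ik; apply; apply: pI.
      apply: eq_from_tnth => j; apply/eqP/negPn/negP => nj.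
      by apply: noj; exists j.
    exists (`|(tnth (p i) j : R) - tnth (p k) j| / 2).
      by rewrite divr_gt0// normr_gt0 subr_eq0.
    move=> _; exists j; have : 0 < `|(tnth (p i) j : R) - tnth (p k) j|.
      by rewrite normr_gt0 subr_eq0.
    by lra.
  move=> ik a b a0 ab bP /bP[j bj]; exists j; exact: le_lt_trans bj.
have [h h0 hP] : exists2 h : R, 0 < h & forall s : {set I},
    ~ enclosable p s r ->
    forall y, exists2 i, i \in s & r ^+ 2 + h < sqdist (p i) y.
  apply: (@finite_uniform_pos R _ (fun s h => ~ enclosable p s r ->
    forall y, exists2 i, i \in s & r ^+ 2 + h < sqdist (p i) y)).
    move=> s; have [ps|ps] := pselect (enclosable p s r); first by exists 1.
    by have [h h0 hP] := enclosable_gap (ltW r0) ps; exists h.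
  move=> s a b a0 ab bP /bP{}bP y; have [i si bi] := bP y; exists i => //.
  by apply: le_lt_trans bi; rewrite lerD2l.
(* Chosen so that [4 * n * (r ^+ 2 + h) = h]: for [c = 1 - n], the Bernoulli bound
   [1 - 4 * n <= c ^+ 4] yields [c4]. *)
pose n := h / (4 * (r ^+ 2 + h)).
have rh0 : 0 < r ^+ 2 + h by rewrite addr_gt0.
have n0 : 0 < n by rewrite divr_gt0// mulr_gt0.
have nE : n * (4 * (r ^+ 2 + h)) = h by rewrite mulfVK// gt_eqF// mulr_gt0.
have n1 : n < 4^-1 by rewrite ltr_pdivrMr ?mulr_gt0//; lra.
pose c := 1 - n.
have c0 : 0 < c by rewrite /c; lra.
have c1 : c < 1 by rewrite /c; lra.
have c01 : 0 <= c <= 1 by rewrite !ltW.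
have c4 : r ^+ 2 <= c ^+ 4 * (r ^+ 2 + h).
  have : 1 - 4 * n <= c ^+ 4.
    by rewrite /c; nra.
  rewrite -(ler_pM2r rh0); apply: le_trans; lra.
(* The first bound gives [2 * e < c * g], so the shrunken points stay separated. The second bounds
   the Euclidean displacement by [(1 - c) * r], since [d <= d.+1 ^ 2]; [d.+1] is never zero. *)
pose e := Num.min (c * g / 3) ((1 - c) * r / d.+1%:R).
have e0 : 0 < e by rewrite lt_min !divr_gt0// mulr_gt0// subr_gt0.
have e1 : e <= c * g / 3 by rewrite ge_min lexx.
have e2 : d%:R * e ^+ 2 <= (1 - c) ^+ 2 * r ^+ 2.
  have e2 : d.+1%:R * e <= (1 - c) * r.
    by rewrite mulrC -ler_pdivlMr// ge_min lexx orbT.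
  rewrite -exprMn; apply: (@le_trans _ _ ((d.+1%:R * e) ^+ 2)).
    rewrite exprMn ler_wpM2r ?sqr_ge0// -natrX ler_nat.
    by rewrite (leq_trans (leqnSn d))// -[leqLHS]expn1 leq_pexp2l.
  by rewrite lerXn2r// nnegrE mulr_ge0// ?subr_ge0 ltW.
exists (fun i => scale_point c (p i)); exists e => //; split.
  move=> i k ik; have [j gj] := gP (i, k) ik; exists j.
  rewrite !tnth_scale_point -mulrBr normrM (gtr0_norm c0).
  apply: (@lt_le_trans _ _ (c * g)).
    by have : 0 < c * g; [exact: mulr_gt0|lra].
  by rewrite ler_pM2l// ltW.
move=> x xq s.
have xq2 i : sqdist (x i) (scale_point c (p i)) <= (1 - c) ^+ 2 * r ^+ 2.
  by apply: le_trans e2; exact: sqdist_sup_le.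
have c1N : 1 - c != 0 by rewrite subr_eq0 gt_eqF.
have cN : c != 0 by rewrite gt_eqF.
split=> [[y py]|[y xy]].
  (* [x i - c y] is the convex combination, with weights [c] and [1 - c], of [p i - y] and
     [(x i - c p i) / (1 - c)], both of norm at most [r]. *)
  exists (scale_point c y) => i si; rewrite euclidean_dist_le ?(ltW r0)//.
  have := py i si; rewrite euclidean_dist_le ?(ltW r0)// => {}py.
  apply: (@le_trans _ _ (c * sqdist (p i) y + (1 - c) *
      sqdist (scale_point (1 - c)^-1 (x i))
             (scale_point (1 - c)^-1 (scale_point c (p i))))).
    by apply: sqdist_convex => // j; rewrite !tnth_scale_point; field.
  rewrite sqdist_scale exprVn.
  have : (1 - c) ^- 2 * sqdist (x i) (scale_point c (p i)) <= r ^+ 2.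
    by rewrite mulrC ler_pdivrMr ?exprn_gt0 ?subr_gt0// mulrC.
  by nra.
(* Otherwise the gap at the center [y / c] produces a point [p i] that is too far. But [p i - y / c]
   is the convex combination of [(x i - y) / c ^+ 2] and [(c p i - x i) / (c * (1 - c))]. *)
apply: contrapT => /hP/(_ (scale_point c^-1 y))[i si].
rewrite ltNge => /negP; apply.
have := xy i si; rewrite euclidean_dist_le ?(ltW r0)// => {}xy.
apply: (@le_trans _ _ (c *
    sqdist (scale_point (c ^- 2) (x i)) (scale_point (c ^- 2) y) +
  (1 - c) * sqdist (scale_point (c * (1 - c))^-1 (scale_point c (p i)))
                     (scale_point (c * (1 - c))^-1 (x i)))).
  by apply: sqdist_convex => // j; rewrite !tnth_scale_point; field;
    rewrite cN c1N.
rewrite !sqdist_scale.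
have xq' : sqdist (scale_point c (p i)) (x i) <= (1 - c) ^+ 2 * r ^+ 2.
  apply: le_trans e2; apply: sqdist_sup_le => j.
  by rewrite distrC.
apply: (@le_trans _ _ (c * ((c ^- 2) ^+ 2 * r ^+ 2) +
    (1 - c) * ((c * (1 - c))^-1 ^+ 2 * ((1 - c) ^+ 2 * r ^+ 2)))).
  apply: lerD.
    by rewrite ler_pM2l// ler_wpM2l ?sqr_ge0.
  by rewrite ler_pM2l ?subr_gt0// ler_wpM2l ?sqr_ge0.
have -> : c * ((c ^- 2) ^+ 2 * r ^+ 2) +
    (1 - c) * ((c * (1 - c))^-1 ^+ 2 * ((1 - c) ^+ 2 * r ^+ 2)) =
    ((c + c ^+ 2 * (1 - c)) * r ^+ 2) / c ^+ 4.
  by field; rewrite cN c1N.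
(* As [c ^+ 2 <= 1], the coefficient [c + c ^+ 2 * (1 - c)] is at most 1, and [c4] absorbs the
   division by [c ^+ 4]. *)
rewrite ler_pdivrMr ?exprn_gt0// [leRHS]mulrC; apply: le_trans c4.
rewrite ler_piMl ?(ltW r2)//.
have : c ^+ 2 <= 1 by rewrite expr_le1// ltW.
by nra.
Qed.

(** * Combinatorial equivalence and Čech complexes *)

Lemma simplicial_complex_eq (T : choiceType) (K L : simplicial_complex T) :
  faces K = faces L -> K = L.
Proof.
case: K L => [F F0 FS] [G G0 GS] /= FG; move: F0 FS; rewrite FG => F0 FS.
by congr SimplicialComplex; exact: Prop_irrelevance.
Qed.

(** Vertex maps are total functions; a vertex of [K] serves as the value of the inverse outside
    [vertices L]. *)
Lemma combinatorially_equivalent_sym (T U : choiceType)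
    (K : simplicial_complex T) (L : simplicial_complex U) :
  vertices K !=set0 ->
  combinatorially_equivalent K L -> combinatorially_equivalent L K.
Proof.
move=> [v0 _] [f [fun_f inj_f surj_f] fE].
have /choice[g gP] : forall u, exists v,
    vertices L u -> vertices K v /\ f v = u.
  move=> u; have [Lu|nLu] := pselect (vertices L u); last by exists v0.
  by have [v Kv <-] := surj_f _ Lu; exists v.
have gK v : vertices K v -> g (f v) = v.
  move=> Kv; have [Kg fg] := gP _ (fun_f _ Kv).
  by apply: inj_f; rewrite ?inE.
exists g; first split.
- by move=> u /gP[].
- move=> u v; rewrite !inE => /gP[_ fgu] /gP[_ fgv] guv.
  by rewrite -fgu -fgv guv.
- by move=> v Kv; exists (f v); [exact: fun_f|exact: gK].
move=> s sL; rewrite fE; last first.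
  by move=> v /= /imfsetP[u us ->]; have [] := gP _ (sL _ us).
suff -> : (f @` (g @` s) = s)%fset by [].
apply/fsetP => u; apply/imfsetP/idP => [[_ /= /imfsetP[w ws ->] ->]|us].
  by have [_ ->] := gP _ (sL _ ws).
exists (g u); first exact: in_imfset.
by have [_ ->] := gP _ (sL _ us).
Qed.

Lemma combinatorially_equivalent_trans (T U W : choiceType)
    (K : simplicial_complex T) (L : simplicial_complex U)
    (M : simplicial_complex W) :
  combinatorially_equivalent K L -> combinatorially_equivalent L M ->
  combinatorially_equivalent K M.
Proof.
move=> [f bij_f fE] [g bij_g gE].
exists (g \o f); first exact: set_bij_comp bij_f bij_g.
move=> s sK; rewrite fE// gE; last first.
  move=> u /= /imfsetP[v vs ->]; case: bij_f => + _ _; apply; exact: sK.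
suff -> : (g @` (f @` s) = (g \o f) @` s)%fset by [].
apply/fsetP => w; apply/imfsetP/imfsetP => [[_ /= /imfsetP[v vs ->] ->]|].
  by exists v.
by move=> [v /= vs ->]; exists (f v) => //; exact: in_imfset.
Qed.

(** The map [p i] to [x i] preserves index sets, and being a face depends only on the index set
    being enclosable. *)
Lemma cech_equivalent (R : realType) (d : nat) (I : finType)
    (p x : I -> euclidean R d) (rho : R) : 0 <= rho ->
  injective p -> injective x ->
  (forall s, enclosable p s (rho / 2) <-> enclosable x s (rho / 2)) ->
  combinatorially_equivalent (cech (range p) rho) (cech (range x) rho).
Proof.
move=> rho0 pI xI px.
pose f y := if [pick i | p i == y] is Some i then x i else y.
have fp i : f (p i) = x i.
  by rewrite /f; case: pickP => [k /eqP/pI ->//|/(_ i)]; rewrite eqxx.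
exists f; rewrite !vertices_cech//.
  split=> [_ [i _ <-]|y z|_ [i _ <-]].
  - by exists i.
  - by move=> /set_mem[i _ <-] /set_mem[k _ <-]; rewrite !fp => /xI ->.
  - by exists (p i).
move=> s sp; pose S := finset (fun i => p i \in s).
have memS i : (i \in S) = (p i \in s) by rewrite finset.in_set.
have fs y : y \in (f @` s)%fset <-> exists2 i, i \in S & y = x i.
  split=> [/imfsetP[z /= zs ->]|[i]].
    by have [i _ pz] := sp _ zs; exists i; rewrite ?memS ?pz// -pz fp.
  by rewrite memS => ps ->; rewrite -fp; exact: in_imfset.
rewrite /= /cech_faces /=; split=> [[s0 _ [y sy]]|[s0 _ [y sy]]].
  have [|z xz] := (px S).1; first by exists y => i; rewrite memS; exact: sy.
  split.
  - have /fset0Pn[u us] := s0; apply/fset0Pn; exists (f u); exact: in_imfset.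
  - by move=> u /fs[i _ ->]; exists i.
  - by exists z => u /fs[i si ->]; exact: xz.
have [|z pz] := (px S).2.
  by exists y => i si; apply: sy; apply/fs; exists i.
split => //.
- by have /fset0Pn[u /imfsetP[v vs _]] := s0; apply/fset0Pn; exists v.
- exists z => u us; have [i _ pu] := sp _ us; rewrite -pu; apply: pz.
  by rewrite memS pu.
Qed.

(** Ball centers range over the whole space, so discarding points outside [W] does not affect the
    faces on [W]. *)
Lemma induced_cech (R : realType) (d : nat) (X W : set (euclidean R d))
    (rho : R) :
  W `<=` X -> induced_subcomplex (cech X rho) W = cech W rho.
Proof.
move=> WX; apply: simplicial_complex_eq; apply/seteqP; split=> s /=.
  by move=> [[s0 _ sy] sW].
by move=> [s0 sW sy]; split => //; split => // u /sW/WX.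
Qed.

(** Both endpoints lie within [rho / 2] of a common center. The coordinatewise form suits comparison
    with cubes. *)
Lemma cech_edge_coord (R : realType) (d : nat) (X : set (euclidean R d))
    (rho : R) (x y : euclidean R d) j : 0 <= rho ->
  faces (cech X rho) [fset x; y]%fset -> `|(tnth x j : R) - tnth y j| <= rho.
Proof.
move=> rho0 [_ _ [c cP]].
have r0 : 0 <= rho / 2 by rewrite divr_ge0.
have close u : u \in [fset x; y]%fset ->
    `|(tnth u j : R) - tnth c j| <= rho / 2.
  move=> /cP; rewrite euclidean_dist_le// => ud.
  rewrite -(ler_sqr (normr_ge0 _)) ?nnegrE// real_normK ?num_real//.
  exact: le_trans (sqr_coord_le _ _ _) ud.
have := close x; have := close y.
rewrite !inE !eqxx orbT distrC => /(_ isT) cy /(_ isT) xc.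
have -> : rho = rho / 2 + rho / 2 by lra.
have -> : (tnth x j : R) - tnth y j =
    ((tnth x j : R) - tnth c j) + ((tnth c j : R) - tnth y j).
  by rewrite subrKA.
by apply: le_trans (ler_normD _ _) _; exact: lerD.
Qed.

(** * Cubes and atoms of integer-valued measures *)

Definition cube (R : realType) (d : nat) (c : euclidean R d) (e : R) :
    set (euclidean R d) :=
  [set x | forall j,
    `[(tnth c j : R) - e, (tnth c j : R) + e]%classic (tnth x j)].

Section cubes.
Context {R : realType} {d : nat}.
Implicit Types (c x y : euclidean R d) (e : R).

Lemma cubeP c e x : cube c e x <-> forall j, `|(tnth x j : R) - tnth c j| <= e.
Proof.
by split=> cx j; have := cx j; rewrite /= in_itv/= ler_distl.
Qed.

Lemma measurable_cube c e : measurable (cube c e).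
Proof.
rewrite [X in measurable X](_ : _ = \bigcap_(j in [set: 'I_d])
    ((fun x : euclidean R d => tnth x j) @^-1`
      `[(tnth c j : R) - e, (tnth c j : R) + e]%classic)).
  apply: fin_bigcap_measurable => [|j _]; first exact: finite_finset.
  by rewrite -[X in measurable X]setTI; exact: measurable_tnth.
by apply/seteqP; split=> [x cx j _|x cx j]; [exact: cx|exact: (cx j I)].
Qed.

Lemma lebesgue_measure_cube c e : 0 < e ->
  lebesgue_measure_euclidean R d (cube c e) = ((2 * e) ^+ d)%:E.
Proof.
move=> e0; rewrite /cube (lebesgue_measure_euclidean_box (A := fun j =>
  `[(tnth c j : R) - e, (tnth c j : R) + e]%classic)); last by [].
rewrite (eq_bigr (fun=> (2 * e)%:E)); last first.
  move=> j _; rewrite lebesgue_measure_itv/= lte_fin ifT; last by lra.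
  by rewrite -EFinD; congr EFin; lra.
elim: d => [|n IH]; first by rewrite big_ord0.
by rewrite big_ord_recl IH -EFinM exprS.
Qed.

Lemma cube0 c : cube c 0 = [set c].
Proof.
apply/seteqP; split=> [x /cubeP cx|_ ->].
  apply: eq_from_tnth => j; apply/eqP; rewrite -subr_eq0 -normr_le0.
  exact: cx.
by apply/cubeP => j; rewrite subrr normr0.
Qed.

Lemma measurable_point c : measurable [set c].
Proof. by rewrite -cube0; exact: measurable_cube. Qed.

Lemma support_null (mu : {measure set (euclidean R d) -> \bar R}) B x :
  measurable B -> mu B = 0%E -> support_of mu x -> ~ B x.
Proof.
rewrite /support_of /= => mB B0 mux Bx; move: mux.
rewrite ltNge => /negP; apply.
rewrite -B0; apply: le_measure; rewrite ?inE//; last by move=> _ ->.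
exact: measurable_point.
Qed.

(* Countably many half-spaces separate points. A set of unit mass sees only one
   side of each of them, hence only one point. *)
Lemma unit_mass_atom (mu : {measure set (euclidean R d) -> \bar R}) C :
  (forall B, measurable B -> mu B = +oo%E \/ exists k : nat, mu B = k%:R%:E) ->
  measurable C -> mu C = 1%E -> exists x, support_of mu `&` C = [set x].
Proof.
move=> muN mC muC1.
pose H (jr : 'I_d * rat) : set (euclidean R d) :=
  (fun x => tnth x jr.1) @^-1` `]-oo, ratr jr.2]%classic.
have mH jr : measurable (H jr).
  by rewrite -[X in measurable X]setTI; exact: measurable_tnth.
(* Enumerates the half-spaces; numbers encoding none of them give [setT]. *)
pose D k := oapp H setT (choice.unpickle k).
have mD k : measurable (D k) 
  by rewrite /D; case: (choice.unpickle k) => [jr|];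
    [exact: mH|exact: measurableT].
(* The side of [D k] that carries the mass of [C]: by integrality, the part of [C] in [D k] has mass
   0 or 1. *)
pose A k := if mu (C `&` D k) == 1%E then D k else ~` D k.
have mA k : measurable (A k).
  by rewrite /A; case: eqP => // _; exact: measurableC.
have CA k : mu (C `\` A k) = 0%E.
  rewrite /A; case: eqP => [D1|nD1].
    have -> : (mu (C `\` D k) = mu C - mu (C `&` D k))%E.
      by apply: measureD => //; rewrite [ltLHS]muC1 ltry.
    by rewrite muC1 D1 subee.
  rewrite setDE setCK.
  have : (mu (C `&` D k) <= 1)%E.
    rewrite -muC1; apply: le_measure; rewrite ?inE//; exact: measurableI.
  have [->|[n nE]] := muN _ (measurableI _ _ mC (mD k)).
    by rewrite leNgt ltry.
  move: nD1; rewrite nE lee_fin lern1; case: n {nE} => [|[|n]] //.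
pose G := C `&` \bigcap_k A k.
have mG : measurable G by apply: measurableI => //; exact: bigcap_measurable.
have CG : mu (C `\` G) = 0%E.
  have -> : C `\` G = \bigcup_k (C `\` A k).
    rewrite setDIr setDv set0U setDE setC_bigcap setI_bigcupr.
    by apply: eq_bigcupr => k _; rewrite setDE.
  apply/negligibleP.
    by apply: bigcup_measurable => k _; exact: measurableD.
  apply: negligible_bigcup => k; apply/negligibleP;
    [exact: measurableD|exact: CA].
have G1 : mu G = 1%E.
  have : (mu C = mu (C `\` G) + mu (C `&` G))%E by exact: measureDI.
  rewrite CG add0e muC1 => ->.
  by congr (mu _); apply/seteqP; split=> y; rewrite /G; [case|move=> [Cy Gy]].
have [x Gx] : G !=set0.
  apply/set0P/eqP => G0; move: G1; rewrite G0 measure0 => /esym/eqP.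
  by rewrite onee_eq0.
have Gsub : G `<=` [set x].
  (* A rational between the two coordinates gives a half-space containing [u] but not [v], whereas
     [G] lies on one side of it. *)
  have sep u v j : G u -> G v -> ~ ((tnth u j : R) < tnth v j).
    move=> [_ Gu] [_ Gv] /rat_in_itvoo[r]; rewrite in_itv/= => /andP[ur rv].
    have := Gu (choice.pickle (j, r)) I; have := Gv (choice.pickle (j, r)) I.
    rewrite /A; case: eqP => _; rewrite /D choice.pickleK /H /= !in_itv/=.
      by rewrite leNgt rv.
    by move=> _; apply; exact: ltW.
  move=> y Gy; apply: eq_from_tnth => j; apply/eqP.
  by rewrite eq_le !leNgt; apply/andP; split; apply/negP; exact: sep.
have {Gsub Gx} GE : G = [set x].
  by apply/seteqP; split => // _ ->.
exists x; apply/seteqP; split=> [y [muy Cy]|_ ->].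
  (* A second support point in [C] would lie in the null set [C] minus [G]. *)
  apply: contrapT => xy.
  apply: (support_null (measurableD mC mG) CG muy).
  by split => //; rewrite GE.
split; first by rewrite /support_of /= -GE G1 lte01.
by have [] : G x by rewrite GE.
Qed.

End cubes.

(** * Independent events occurring infinitely often *)

(* Induction on [s1]: splitting along [E n] removes one complement. *)
Lemma independent_complements (disp : measure_display)
    (Omega : measurableType disp) (R : realType) (P : probability Omega R)
    (E : nat -> set Omega) (a : nat -> R) :
  (forall n, measurable (E n)) ->
  (forall s, uniq s ->
    P (\big[setI/setT]_(n <- s) E n) = (\prod_(n <- s) a n)%:E) ->
  forall s1 s2, uniq (s1 ++ s2) ->
  P (\big[setI/setT]_(n <- s1) ~` E n `&` \big[setI/setT]_(n <- s2) E n) =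
  (\prod_(n <- s1) (1 - a n) * \prod_(n <- s2) a n)%:E.
Proof.
move=> mE indepE; elim=> [|n s1 IH] s2 s12.
  by rewrite !big_nil setTI mul1r indepE.
have mX : measurable (\big[setI/setT]_(i <- s1) ~` E i).
  by apply: bigsetI_measurable => i _; exact: measurableC.
have mY : measurable (\big[setI/setT]_(i <- s2) E i).
  by apply: bigsetI_measurable => i _.
have us2 : uniq (s1 ++ n :: s2) by rewrite -cat1s uniq_catCA.
have us1 : uniq (s1 ++ s2) by move: s12 => /= /andP[].
have := IH _ us2; have := IH _ us1; rewrite !big_cons.
set X := \big[setI/setT]_(i <- s1) _; set Y := \big[setI/setT]_(i <- s2) _.
move=> XY XEY.
have : (P (X `&` Y) = P ((X `&` Y) `\` E n) + P ((X `&` Y) `&` E n))%E.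
  by apply: measureDI => //; exact: measurableI.
have -> : (X `&` Y) `&` E n = X `&` (E n `&` Y).
  by rewrite -setIA [Y `&` _]setIC.
have -> : (X `&` Y) `\` E n = ~` E n `&` X `&` Y by rewrite setDE setIC setIA.
have fin : P (~` E n `&` X `&` Y) \is a fin_num.
  by apply: fin_num_measure; do 2?apply: measurableI => //; exact: measurableC.
rewrite XY XEY -(fineK fin) -EFinD => -[h]; congr EFin.
by rewrite mulrBl mul1r mulrBl -mulrA [a n * _]mulrCA h addrK.
Qed.

Lemma eq0_le_geometric (R : realType) (x q : R) : 0 <= x -> 0 <= q < 1 ->
  (forall k, x <= q ^+ k) -> x = 0.
Proof.
move=> x0 /andP[q0 q1] xq; apply/eqP; rewrite eq_le x0 andbT.
have qk : (fun k => q ^+ k) @ \oo --> 0 by apply: cvg_expr; rewrite ger0_norm.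
rewrite -(cvg_lim (@Rhausdorff R) qk); apply: limr_ge.
  by apply/cvg_ex; exists 0.
by apply: nearW.
Qed.

(** A case of the second Borel-Cantelli lemma: missing all of the [k] events from index [m] on has
    probability at most [(1 - p) ^+ k], so missing every event from [m] on is null. *)
Lemma infinitely_often_independent (disp : measure_display)
    (Omega : measurableType disp) (R : realType) (P : probability Omega R)
    (E : nat -> set Omega) (a : nat -> R) (p : R) :
  (forall n, measurable (E n)) ->
  (forall s, uniq s ->
    P (\big[setI/setT]_(n <- s) E n) = (\prod_(n <- s) a n)%:E) ->
  0 < p -> (forall n, p <= a n) ->
  {ae P, forall w m, exists2 n, (m <= n)%N & E n w}.
Proof.
move=> mE indepE p0 pa.
have PE n : P (E n) = (a n)%:E by have := indepE [:: n] isT; rewrite !big_seq1.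
have a1 n : a n <= 1 by rewrite -lee_fin -PE probability_le1.
have p1 : p <= 1 by exact: le_trans (pa 0%N) (a1 0%N).
pose F m := \bigcap_(n in [set n | (m <= n)%N]) ~` E n.
have mF m : measurable (F m).
  by apply: bigcap_measurable => [|n _]; [exists m => /=|exact: measurableC].
have F0 m : P (F m) = 0%E.
  have Pfin : P (F m) \is a fin_num by exact: fin_num_measure.
  rewrite -(fineK Pfin); congr EFin; apply: (@eq0_le_geometric _ _ (1 - p)).
  - exact: fine_ge0.
  - by rewrite subr_ge0 p1 ltrBlDr ltrDl.
  move=> k; rewrite -lee_fin fineK//.
  have := independent_complements mE indepE (s1 := iota m k) (s2 := [::]).
  rewrite cats0 iota_uniq => /(_ isT).
  rewrite !big_nil setIT mulr1 => Pk.
  apply: (@le_trans _ _ (\prod_(n <- iota m k) (1 - a n))%:E).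
    rewrite -Pk; apply: le_measure; rewrite ?inE//.
      by apply: bigsetI_measurable => n _; exact: measurableC.
    rewrite -bigcap_seq => w Fw n /=; rewrite mem_iota => /andP[mn _].
    exact: Fw.
  rewrite lee_fin; apply: (@le_trans _ _ (\prod_(n <- iota m k) (1 - p))).
    by apply: ler_prod => n _; rewrite subr_ge0 a1 lerD2l lerN2 pa.
  by rewrite -[X in iota m X](addKn m k) prodr_const_nat addKn.
have /negligibleS : P.-negligible (\bigcup_m F m).
  apply: negligible_bigcup => m; exact/(negligibleP _ (mF m)).2/F0.
apply=> w /= /existsNP[m noE]; exists m => // n /= mn Enw.
by apply: noE; exists n.
Qed.

(** * Poisson counts in disjoint cells *)

Lemma poisson_prob_point (R : realType) (r : R) k :
  0 < r -> poisson_prob r 0 [set k] = (poisson_pmf r k)%:E.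
Proof.
by move=> r0; rewrite /poisson_prob r0 esum_set1// lee_fin poisson_pmf_ge0.
Qed.

(** For regions whose volume is only bounded above. At [r = 0] the law is the Dirac mass at 0, hence
    the separate case. *)
Lemma poisson_prob0_ge (R : realType) (r M : R) :
  0 <= r <= M -> ((expR (- M))%:E <= poisson_prob r 0 [set 0%N])%E.
Proof.
rewrite le_eqVlt => /andP[/orP[/eqP <- M0|r0 rM]].
  by rewrite /poisson_prob ltxx diracE mem_set// lee_fin -expR0 ler_expR
    oppr_le0.
rewrite poisson_prob_point// /poisson_pmf r0 expr0 mul1r fact0 invr1 mul1r.
by rewrite lee_fin ler_expR lerN2.
Qed.

Lemma prod_EFin (R : realType) (I : Type) (s : seq I) (f : I -> R) :
  (\prod_(i <- s) (f i)%:E)%E = (\prod_(i <- s) f i)%:E.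
Proof. by elim: s => [|i s IH]; rewrite ?big_nil// !big_cons IH EFinM. Qed.

Section poisson_cells.
Context (d : measure_display) (Omega : measurableType d) (R : realType)
  (P : probability Omega R) (d' : measure_display) (S : measurableType d')
  (eta : Omega -> {measure set S -> \bar R}) (mu : set S -> \bar R).

(** Moves independence from ordinals to arbitrary finite index types, so that pairs can index
    cells. *)
Lemma poisson_process_independent (J : finType) (B : J -> set S)
    (A : J -> set (\bar R)) : poisson_process P eta mu ->
  (forall j, measurable (B j)) -> trivIset setT B ->
  (forall j, measurable (A j)) ->
  P (\bigcap_j ((fun w => eta w (B j)) @^-1` A j)) =
  (\prod_j fine (P ((fun w => eta w (B j)) @^-1` A j)))%:E.
Proof.
move=> [[_ meta] _ indep] mB tB mA.
pose B' (i : 'I_#|J|) := B (enum_val i).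
have tB' : trivIset setT B'.
  by move=> i k _ _ /(tB _ _ I I)/enum_val_inj.
have := indep _ B' (fun i => mB _) tB' (fun i => A (enum_val i))
  (fun i => mA _).
rewrite (_ : \bigcap_i _ = \bigcap_j ((fun w => eta w (B j)) @^-1` A j));
  last first.
  apply/seteqP; split=> w Bw j _; last exact: (Bw (enum_val j)).
  by have := Bw (enum_rank j) I; rewrite /B' /= enum_rankK.
move=> ->; rewrite -prod_EFin [RHS](reindex (@enum_val J (mem J)))/=;
  last first.
  by apply: onW_bij; exact: enum_val_bij.
apply: eq_bigr => i _; rewrite fineK//; apply: fin_num_measure.
by rewrite -[X in measurable X]setTI; apply: meta.
Qed.

(** Joint disjointness of all cells makes the rows [B n] independent of each other, and each row has
    its prescribed counts with probability at least the product of the [b i]. *)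
Lemma poisson_cells_infinitely_often (I : finType) (B : nat -> I -> set S)
    (k : I -> nat) (b : I -> R) : poisson_process P eta mu ->
  (forall n i, measurable (B n i)) ->
  trivIset setT (fun ni => B ni.1 ni.2) ->
  (forall i, 0 < b i) ->
  (forall n i, (b i)%:E <= P [set w | eta w (B n i) = (k i)%:R%:E])%E ->
  {ae P, forall w m, exists2 n, (m <= n)%N &
    forall i, eta w (B n i) = (k i)%:R%:E}.
Proof.
move=> ppp mB tB b0 bP; have [[_ meta] _ _] := ppp.
pose A i : set (\bar R) := [set (k i)%:R%:E].
have mA i : measurable (A i) by exact: emeasurable_set1.
pose E n : set Omega := \bigcap_i ((fun w => eta w (B n i)) @^-1` A i).
pose a n := \prod_i fine (P ((fun w => eta w (B n i)) @^-1` A i)).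
have mEi n i : measurable ((fun w => eta w (B n i)) @^-1` A i).
  by rewrite -[X in measurable X]setTI; apply: meta.
have mE n : measurable (E n).
  by apply: fin_bigcap_measurable => //; exact: finite_finset.
have /(_ _) := @infinitely_often_independent _ _ _ P E a (\prod_i b i) mE.
have : forall s, uniq s ->
    P (\big[setI/setT]_(n <- s) E n) = (\prod_(n <- s) a n)%:E.
  move=> s us.
  (* Flattens the chosen rows into one finite family; [uniq s] keeps it disjoint. *)
  pose B' (ji : 'I_(size s) * I) := B (nth 0%N s ji.1) ji.2.
  have tB' : trivIset setT B'.
    move=> [j i] [j' i'] _ _ /(tB (_, _) (_, _) Logic.I Logic.I)[] /eqP.
    by rewrite nth_uniq// => /eqP/val_inj -> ->.
  have := poisson_process_independent (A := fun ji => A ji.2) ppp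
    (fun ji : 'I_(size s) * I => mB _ _ : measurable (B' ji)) tB'
    (fun _ => mA _).
  rewrite (_ : \bigcap_j _ = \big[setI/setT]_(n <- s) E n); last first.
    rewrite -bigcap_seq; apply/seteqP; split=> w Ew.
      move=> n /= ns i _; rewrite -(nth_index 0%N ns).
      have ins : (index n s < size s)%N by rewrite index_mem.
      exact: (Ew (Ordinal ins, i)).
    by move=> [j i] _; apply: Ew => //=; exact: mem_nth.
  move=> ->; congr EFin.
  rewrite (big_nth 0%N) big_mkord /a.
  by rewrite (pair_bigA _ (fun (j : 'I_(size s)) i =>
    fine (P ((fun w => eta w (B (nth 0%N s j) i)) @^-1` A i)))).
move=> indepE /(_ indepE) h.
have : {ae P, forall w m, exists2 n, (m <= n)%N & E n w}.
  apply: h; first exact: prodr_gt0.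
  move=> n; apply: ler_prod => i _; rewrite (ltW (b0 i))/= -lee_fin fineK ?bP//.
  by apply: fin_num_measure.
apply: filterS => w Ew m; have [n mn Enw] := Ew m.
by exists n => // i; exact: Enw.
Qed.

End poisson_cells.

(** * Translated cells and isolated copies *)

Definition shift_point (R : realType) (d : nat) (a : R) (x : euclidean R d) :
  euclidean R d := [tuple (a + tnth x j : measurableTypeR R) | j < d].

Definition diagonal_point (R : realType) (d : nat) (a : R) : euclidean R d :=
  [tuple (a : measurableTypeR R) | j < d].

Lemma enclosable_shift (R : realType) (d : nat) (a : R) (I : finType)
    (x : I -> euclidean R d) (s : {set I}) (r : R) :
  enclosable x s r -> enclosable (fun i => shift_point a (x i)) s r.
Proof.
move=> [y xy]; exists (shift_point a y) => i /xy; congr (Num.sqrt _ <= _).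
by apply: eq_bigr => j _; rewrite !tnth_mktuple opprD addrACA subrr add0r.
Qed.

Lemma shift_pointK (R : realType) (d : nat) (a : R) (x : euclidean R d) :
  shift_point (- a) (shift_point a x) = x.
Proof. by apply: eq_from_tnth => j; rewrite !tnth_mktuple addKr. Qed.

(** Under the assumptions [sepq] and [qh] below, the cells partition the large cube; the [option]
    index lets small cubes and remainder enter one independence statement. *)
Definition cell (R : realType) (d : nat) (I : finType) (q : I -> euclidean R d)
    (e h a : R) (o : option I) : set (euclidean R d) :=
  match o with
  | Some i => cube (shift_point a (q i)) e
  | None => cube (diagonal_point d a) h `\`
            \bigcup_i cube (shift_point a (q i)) e
  end.

Section cells.
Context (R : realType) (d : nat) (I : finType) (q : I -> euclidean R d)
  (e h : R) (sepq : forall i k, i != k ->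
    exists j, 2 * e < `|(tnth (q i) j : R) - tnth (q k) j|).

Lemma cell_SomeP a i x :
  cell q e h a (Some i) x <->
  forall j, `|(tnth x j : R) - (a + tnth (q i) j)| <= e.
Proof.
by rewrite /cell cubeP; split=> H j; have := H j; rewrite tnth_mktuple.
Qed.

Lemma cube_diagonalP a x :
  cube (diagonal_point d a) h x <-> forall j, `|(tnth x j : R) - a| <= h.
Proof. by rewrite cubeP; split=> H j; have := H j; rewrite tnth_mktuple. Qed.

Lemma measurable_cell a o : measurable (cell q e h a o).
Proof.
case: o => [i|]; first exact: measurable_cube.
apply: measurableD; first exact: measurable_cube.
by apply: fin_bigcup_measurable => [|i _];
  [exact: finite_finset|exact: measurable_cube].
Qed.

Lemma cell_Some_inj a i k x :
  cell q e h a (Some i) x -> cell q e h a (Some k) x -> i = k.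
Proof.
move=> /cell_SomeP xi /cell_SomeP xk; apply: contrapT => /eqP/sepq[j].
rewrite ltNge => /negP; apply.
have -> : (tnth (q i) j : R) - tnth (q k) j =
  ((tnth x j : R) - (a + tnth (q k) j)) - ((tnth x j : R) - (a + tnth (q i) j)).
  by ring.
by rewrite (le_trans (ler_normB _ _))// mulr_natl mulr2n lerD.
Qed.

Context (qh : forall i j, `|tnth (q i) j : R| + e <= h).

Lemma cell_sub a o : cell q e h a o `<=` cube (diagonal_point d a) h.
Proof.
case: o => [i x /cell_SomeP xi|x []//].
apply/cube_diagonalP => j; apply: le_trans (qh i j).
have -> : (tnth x j : R) - a =
    tnth (q i) j + ((tnth x j : R) - (a + tnth (q i) j)).
  by ring.
by rewrite (le_trans (ler_normD _ _))// lerD2l.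
Qed.

(** Translates along the diagonal are apart in every coordinate, and [0 < d] provides one. *)
Lemma trivIset_cells (z : nat -> R) : (0 < d)%N ->
  (forall m n, m != n -> 2 * h < `|z m - z n|) ->
  trivIset setT (fun no => cell q e h (z no.1) no.2).
Proof.
move=> d0 zh [n o] [m o'] _ _ [x /= [xn xm]].
have nm : n = m.
  apply: contrapT => /eqP/zh; rewrite ltNge => /negP; apply.
  have /cube_diagonalP/(_ (Ordinal d0)) bn := cell_sub xn.
  have /cube_diagonalP/(_ (Ordinal d0)) bm := cell_sub xm.
  have -> : z n - z m = ((tnth x (Ordinal d0) : R) - z m) -
      ((tnth x (Ordinal d0) : R) - z n) by ring.
  by rewrite (le_trans (ler_normB _ _))// mulr_natl mulr2n lerD.
subst m; congr pair.
case: o o' xn xm => [i|] [k|] //= xi xk.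
- by rewrite (cell_Some_inj xi xk).
- by case: xk => _ []; exists i.
- by case: xi => _ []; exists k.
Qed.

(* The points of [X] in the large cube form a copy of the configuration, and the
   margin [rho] between the small cubes and the boundary isolates them. *)
Lemma isolated_copy (p : I -> euclidean R d) (rho a : R)
    (X : set (euclidean R d)) :
  0 <= rho -> injective p ->
  (forall x : I -> euclidean R d,
    (forall i j, `|(tnth (x i) j : R) - tnth (q i) j| <= e) ->
    forall s, enclosable p s (rho / 2) <-> enclosable x s (rho / 2)) ->
  (forall i j, `|tnth (q i) j : R| + e + rho <= h) ->
  (forall i, exists x, X `&` cell q e h a (Some i) = [set x]) ->
  X `&` cell q e h a None = set0 ->
  let W := X `&` cube (diagonal_point d a) h in
  isolated_subcomplex (cech X rho) (cech W rho) /\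
  combinatorially_equivalent (cech (range p) rho) (cech W rho).
Proof.
move=> rho0 pI robust qhrho /choice[x xP] X0 W.
have Xx i : X (x i) /\ cell q e h a (Some i) (x i).
  by have : [set x i] (x i) by []; rewrite -xP => -[].
have xI : injective x.
  by move=> i k xik; apply: (@cell_Some_inj a _ _ (x i)); [|rewrite xik];
    exact: (Xx _).2.
have WE : W = range x.
  apply/seteqP; split=> [y [Xy yB]|_ [i _ <-]]; last first.
    by split; [exact: (Xx i).1|apply: cell_sub (Xx i).2].
  have [[i _ yi]|ny] := pselect ((\bigcup_i cube (shift_point a (q i)) e) y).
    exists i => //; have : (X `&` cell q e h a (Some i)) y by [].
    by rewrite xP.
  by have : (X `&` cell q e h a None) y by []; rewrite X0.
split.
  exists W; split.
  - by rewrite vertices_cech// => y [].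
  - by rewrite induced_cech// => y [].
  (* An edge to [y'] would keep each coordinate of [y'] within [h] of [a], placing it in the large
     cube and hence in [W]. *)
  move=> y y'; rewrite WE => -[i _ <-] ny' xy'.
  have Xy' : X y' by case: xy' => _ + _; apply; rewrite /= !inE eqxx orbT.
  have : ~ cube (diagonal_point d a) h y'.
    by move=> By'; apply: ny'; rewrite -WE.
  apply; apply/cube_diagonalP => j.
  apply: le_trans (qhrho i j).
  have := cech_edge_coord j rho0 xy'.
  have /cell_SomeP/(_ j) := (Xx i).2.
  have -> : (tnth y' j : R) - a = tnth (q i) j +
      ((tnth (x i) j : R) - (a + tnth (q i) j)) -
      ((tnth (x i) j : R) - tnth y' j).
    by ring.
  move=> h1 h2; rewrite (le_trans (ler_normB _ _))// lerD//.
  by rewrite (le_trans (ler_normD _ _))// lerD.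
rewrite WE; apply: cech_equivalent => // s.
(* Robustness concerns configurations near [q], so the points are translated back by [a]. *)
rewrite (robust (fun i => shift_point (- a) (x i))); last first.
  move=> i j; rewrite tnth_mktuple; have /cell_SomeP/(_ j) := (Xx i).2.
  by congr (`|_| <= _); ring.
split; last exact: enclosable_shift.
move=> /(enclosable_shift a); congr (enclosable _ _ _); apply/funext => i.
by have := shift_pointK (- a) (x i); rewrite opprK.
Qed.

End cells.

(** * Infinitely many distinct copies, almost surely *)

Lemma infinite_set_of_distinct_images (T : Type) (A : set T) (E : set nat)
    (f : nat -> T) :
  (forall m, exists2 n, (m <= n)%N & E n) -> (forall n, E n -> A (f n)) ->
  (forall m n, E m -> E n -> f m = f n -> m = n) -> infinite_set A.
Proof.
move=> Einf EA finj finA.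
(* Indices outside [E] go to [None], so the preimage of the image of [A] under [Some] lies in [E],
   where [f] is injective. *)
pose g n := if `[< E n >] then Some (f n) else None.
have gE n : (g @^-1` (Some @` A)) n -> E n.
  by rewrite /g /=; case: asboolP => // _ [].
have /finite_seqP[s sE] : finite_set (g @^-1` (Some @` A)).
  apply: finite_preimage; last exact: finite_image.
  move=> m n /set_mem/gE Em /set_mem/gE En; rewrite /g.
  by rewrite !asboolT// => -[]; exact: finj.
have [n mn En] := Einf (\max_(i <- s) i).+1.
have : (g @^-1` (Some @` A)) n.
  by rewrite /g /= asboolT//; exists (f n) => //; exact: EA.
rewrite sE /= => ns; move: mn; rewrite ltnNge => /negP; apply.
exact: leq_bigmax_seq.
Qed.

Theorem theorem4p5 (R : realType) (d : nat) (rho t : R)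
    (T : choiceType) (K : simplicial_complex T)
    (disp : measure_display) (Omega : measurableType disp)
    (P : probability Omega R)
    (eta : Omega -> {measure set (euclidean R d) -> \bar R}) :
  (0 < d)%N -> 0 < rho -> 0 < t ->
  finite_set (vertices K) -> vertices K !=set0 ->
  (exists V : {fset euclidean R d},
     combinatorially_equivalent K (cech [set` V] rho)) ->
  stationary_poisson_process P eta t ->
  {ae P, forall w, infinite_set
    [set L | isolated_subcomplex (cech (support_of (eta w)) rho) L /\
             combinatorially_equivalent L K]}.
Proof.
move=> d0 rho0 t0 _ K0 [V KV] ppp.
pose p (i : V) : euclidean R d := val i.
have pI : injective p by exact: val_inj.
have pV : range p = [set` V].
  apply/seteqP; split=> [_ [i _ <-]|y yV]; first exact: valP.
  by exists (FSetSub yV).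
have [i0] : exists i : V, True.
  case: KV => f [fV _ _] _; case: K0 => v /fV.
  by rewrite vertices_cech ?ltW// -pV => -[i _ _]; exists i.
move=> _; have rho2 : 0 < rho / 2 by rewrite divr_gt0.
have [q [e e0 [sepq robust]]] := robust_configuration pI rho2.
(* The double sum dominates each coordinate; [e] and the margin [rho] are added once, outside it. *)
pose h := \sum_i \sum_j `|tnth (q i) j : R| + e + rho.
have qhrho i j : `|tnth (q i) j : R| + e + rho <= h.
  rewrite !lerD2r (bigD1 i)//= (bigD1 j)//= -addrA lerDl addr_ge0//.
    by apply: sumr_ge0 => k _.
  by apply: sumr_ge0 => k _; apply: sumr_ge0.
have qh i j : `|tnth (q i) j : R| + e <= h.
  by apply: le_trans (qhrho i j); rewrite lerDl ltW.
have h0 : 0 < h by apply: lt_le_trans (qh i0 (Ordinal d0)); rewrite ltr_wpDl.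
(* Spacing [3 * h] exceeds the side [2 * h], so the closed large cubes are disjoint. *)
pose z (n : nat) : R := n%:R * (3 * h).
have zh m n : m != n -> 2 * h < `|z m - z n|.
  wlog mn : m n / (n < m)%N.
    move=> H; rewrite neq_ltn => /orP[mn|nm]; last first.
      by apply: H; rewrite ?gtn_eqF.
    by rewrite distrC; apply: H; rewrite ?gtn_eqF.
  have h3 : 0 <= (m - n)%:R * (3 * h) by rewrite !mulr_ge0// ltW.
  move=> _; rewrite -mulrBl -natrB ?(ltnW mn)// ger0_norm//.
  have : 1 <= (m - n)%:R :> R by rewrite ler1n subn_gt0.
  by nra.
pose B n o := cell q e h (z n) o.
pose vol := t * (2 * e) ^+ d.
have vol0 : 0 < vol by rewrite mulr_gt0// exprn_gt0// mulr_gt0.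
pose k (o : option V) : nat := if o is Some _ then 1%N else 0%N.
(* A small cube gets its exact probability of one point, the same for all translates; the remainder
   gets the void probability of the full cube, a lower bound by monotonicity. *)
pose b (o : option V) : R :=
  if o is Some _ then poisson_pmf vol 1 else expR (- (t * (2 * h) ^+ d)).
have b0 o : 0 < b o.
  case: o => [i|]; last exact: expR_gt0.
  by rewrite /b /poisson_pmf vol0 expr1 factS fact0 invr1 mulr1 mulr_gt0
    ?expR_gt0.
have bP n o : ((b o)%:E <= P [set w | eta w (B n o) = (k o)%:R%:E])%E.
  have [_ /(_ _ (measurable_cell q e h (z n) o)) + _] := ppp.
  case: o => [i|].
    rewrite /= lebesgue_measure_cube// -EFinM /= => /(_ 1%N) ->.
    by rewrite poisson_prob_point.
  set mu := lebesgue_measure_euclidean R d _.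
  have mule : (mu <= ((2 * h) ^+ d)%:E)%E.
    rewrite -(lebesgue_measure_cube (diagonal_point d (z n)) h0).
    apply: le_measure; rewrite ?inE//; last exact: cell_sub.
      exact: measurable_cell.
    exact: measurable_cube.
  have mu0 : (0 <= mu)%E by exact: measure_ge0.
  have mufin : mu \is a fin_num.
    by rewrite ge0_fin_numE// (le_lt_trans mule) ?ltry.
  rewrite -(fineK mufin) -EFinM /= => /(_ 0%N) ->.
  apply: poisson_prob0_ge; rewrite mulr_ge0 ?fine_ge0 ?(ltW t0)//=.
  by rewrite ler_pM2l// -lee_fin fineK.
have tB : trivIset setT (fun no => B no.1 no.2) by exact: trivIset_cells.
have := poisson_cells_infinitely_often ppp
  (fun n o => measurable_cell q e h (z n) o) tB b0 bP.
have [[etaN _] _ _] := ppp.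
apply: filterS => w io.
pose W n := support_of (eta w) `&` cube (diagonal_point d (z n)) h.
pose E n := forall o, eta w (B n o) = (k o)%:R%:E.
have copy n : E n ->
    isolated_subcomplex (cech (support_of (eta w)) rho) (cech (W n) rho) /\
    combinatorially_equivalent (cech (range p) rho) (cech (W n) rho).
  move=> En; apply: (isolated_copy sepq qh (ltW rho0) pI robust qhrho).
    move=> i; apply: (unit_mass_atom (etaN w)); first exact: measurable_cell.
    exact: (En (Some i)).
  apply/seteqP; split => // x [Sx Bx].
  by apply: (support_null _ _ Sx Bx); [exact: measurable_cell|exact: (En None)].
have KW n : E n -> combinatorially_equivalent K (cech (W n) rho).
  by move=> /copy[_]; apply: combinatorially_equivalent_trans; rewrite pV.
apply: (infinite_set_of_distinct_images io (f := fun n => cech (W n) rho)).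
  move=> n En; split; first exact: (copy n En).1.
  exact: combinatorially_equivalent_sym (KW n En).
(* Equal complexes share their vertex set, which is nonempty because [K] has a vertex; a common
   point of two large cubes contradicts the spacing. *)
move=> m n Em En WE; apply: contrapT => /eqP/zh.
have [x Wx] : W m !=set0.
  case: (KW m Em) => f [fW _ _] _; case: K0 => v /fW.
  by rewrite vertices_cech ?ltW// => Wv; exists (f v).
have Wnx : W n x.
  by rewrite -(vertices_cech (W n) (ltW rho0)) -WE vertices_cech// ltW.
have /cube_diagonalP/(_ (Ordinal d0)) bm := Wx.2.
have /cube_diagonalP/(_ (Ordinal d0)) bn := Wnx.2.
rewrite ltNge => /negP; apply.
have -> : z m - z n = ((tnth x (Ordinal d0) : R) - z n) -
    ((tnth x (Ordinal d0) : R) - z m) by ring.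
by rewrite (le_trans (ler_normB _ _))// mulr_natl mulr2n lerD.
Qed.
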